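(* Let $p$ be a prime, let $0,\alpha,\beta$ be distinct integers, and let $R=\mathbb{Z}_p[x]/x(x-\alpha)(x-\beta)\mathbb{Z}_p[x]$. If $([\alpha],[\beta],[\beta-\alpha])=(1,1,2)$, then, writing $x=p^{-s}$, $$(1-x)^3\zeta_R(s)=p^4x^8-2p^3x^7+(p^3+p^2)x^6+(p^3-2p^2)x^5+px^4+(p^2-2p)x^3+(p+1)x^2-2x+1.$$
   Context: $\mathbb{Z}_p=\{a/b\mid a,b\in\mathbb{Z},\ p\nmid b\}$ is the localization of $\mathbb{Z}$ at $p$. For nonzero $a\in\mathbb{Z}_p$, $[a]$ is the unique non-negative integer $r$ with $a\mathbb{Z}_p=p^r\mathbb{Z}_p$. $\zeta_R(s)=\sum_I |R:I|^{-s}$, where $I$ runs over the full ideals of $R$ (ideals of finite index), viewed as a formal power series in $p^{-s}$. In the formula $x$ denotes $p^{-s}$ (not the polynomial variable). *)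

(* Defs.v *)
From HB Require Import structures.
From mathcomp Require Import all_boot all_order all_algebra.
From mathcomp Require Import finmap boolp classical_sets functions cardinality.

Set Implicit Arguments.
Unset Strict Implicit.
Unset Printing Implicit Defensive.

Import Order.TTheory GRing.Theory Num.Theory.
Local Open Scope ring_scope.
Local Open Scope classical_set_scope.

Definition Zloc_pred (p : nat) (p_pr : prime p) : {pred rat} :=
  fun r => `[< exists a b : int, ~~ (p%:Z %| b)%Z /\ r = a%:~R / b%:~R >].

Fact Zloc_subring_closed (p : nat) (p_pr : prime p) :
  subring_closed (Zloc_pred p_pr).
Proof.
have nz (b : int) : ~~ (p%:Z %| b)%Z -> b%:~R != 0 :> rat.
  by apply: contraNneq => /eqP; rewrite intr_eq0 => /eqP ->; rewrite dvdz0.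
have ndM (b d : int) : ~~ (p%:Z %| b)%Z -> ~~ (p%:Z %| d)%Z ->
    ~~ (p%:Z %| b * d)%Z.
  by rewrite !dvdzE abszM Euclid_dvdM // negb_or => -> ->.
split.
- apply/asboolP; exists 1, 1; split; last by rewrite divr1.
  by rewrite dvdzE /= dvdn1 neq_ltn prime_gt1 ?orbT.
- move=> _ _ /asboolP[a [b [pb ->]]] /asboolP[c [d [pd ->]]].
  apply/asboolP; exists (a * d - c * b), (b * d); split; first exact: ndM.
  by rewrite -mulNr addf_div ?nz // rmorphB !rmorphM /= mulNr.
- move=> _ _ /asboolP[a [b [pb ->]]] /asboolP[c [d [pd ->]]].
  apply/asboolP; exists (a * c), (b * d); split; first exact: ndM.
  by rewrite !rmorphM /= mulf_div.
Qed.

HB.instance Definition _ (p : nat) (p_pr : prime p) :=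
  GRing.isSubringClosed.Build rat (Zloc_pred p_pr) (Zloc_subring_closed p_pr).

Record Zloc (p : nat) (p_pr : prime p) : predArgType :=
  MkZloc { Zloc_val : rat; _ : Zloc_val \in Zloc_pred p_pr }.

HB.instance Definition _ (p : nat) (p_pr : prime p) :=
  [isSub for @Zloc_val p p_pr].
HB.instance Definition _ (p : nat) (p_pr : prime p) :=
  [Choice of Zloc p_pr by <:].
HB.instance Definition _ (p : nat) (p_pr : prime p) :=
  [SubChoice_isSubComNzRing of Zloc p_pr by <:].

Definition principal (A : comNzRingType) (a : A) : set A :=
  [set a * u | u in [set: A]].

(* The value is relevant only for a != 0, where r exists and is unique. *)
Definition pord (p : nat) (p_pr : prime p) (a : Zloc p_pr) : nat :=
  xget 0%N [set r | principal a = principal (p%:R ^+ r : Zloc p_pr)].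

Definition is_ideal (A : comNzRingType) (I : set A) : Prop :=
  [/\ I 0, (forall u v, I u -> I v -> I (u + v))
    & (forall a u, I u -> I (a * u))].

Definition cosets (A : comNzRingType) (I : set A) : set (set A) :=
  [set [set y | I (y - x)] | x in [set: A]].

Definition full_ideal (A : comNzRingType) (I : set A) : Prop :=
  is_ideal I /\ finite_set (cosets I).

(* fset_set of an infinite set is empty, so this is |A : I| for full I. *)
Definition ideal_index (A : comNzRingType) (I : set A) : nat :=
  #|` fset_set (cosets I)|.

Definition full_ideals_of_index (A : comNzRingType) (n : nat) : set (set A) :=
  [set I | full_ideal I /\ ideal_index I = n].

(* A formal power series over int is its sequence of coefficients. *)
Definition fps : Type := nat -> int.

Definition fps_mul (f g : fps) : fps :=
  fun n => \sum_(i < n.+1) f i * g (n - i)%N.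

Definition fps_of_poly (P : {poly int}) : fps := fun n => P`_n.

(* The sum over full ideals I of |A : I|^-s makes sense as a formal power
   series in p^-s: every index is a power of p, and each power of p is the
   index of only finitely many ideals. *)
Definition zeta_is_fps (p : nat) (A : comNzRingType) : Prop :=
  (forall I : set A, full_ideal I -> exists k, ideal_index I = (p ^ k)%N) /\
  (forall k, finite_set (@full_ideals_of_index A (p ^ k)%N)).

(* Collecting the terms |A : I|^-s = (p^-s)^k. *)
Definition zeta (p : nat) (A : comNzRingType) : fps :=
  fun k => Posz #|` fset_set (@full_ideals_of_index A (p ^ k)%N)|.

Definition cubic (A : comNzRingType) (alpha beta : int) : {poly A} :=
  'X * ('X - (alpha%:~R)%:P) * ('X - (beta%:~R)%:P).

Lemma cubic_monic (A : comNzRingType) (alpha beta : int) :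
  cubic A alpha beta \is monic.
Proof. by rewrite !monicMl ?monicX ?monicXsubC. Qed.

(* {poly A %/ h} is the quotient by h only when h is monic of size > 1. *)
Lemma mk_monic_cubic (A : comNzRingType) (alpha beta : int) :
  mk_monic (cubic A alpha beta) = cubic A alpha beta.
Proof.
rewrite /mk_monic cubic_monic andbT /cubic.
have monXa : 'X * ('X - (alpha%:~R)%:P) \is @monic A.
  by rewrite monicMl ?monicX ?monicXsubC.
rewrite size_monicM ?monic_neq0 ?monicXsubC //.
by rewrite size_monicM ?monicX ?monic_neq0 ?monicXsubC // size_polyX !size_XsubC.
Qed.

Definition cubic_quotient (p : nat) (p_pr : prime p) (alpha beta : int) :
  comNzRingType := {poly %/ cubic (Zloc p_pr) alpha beta}.

(* Main.v *)
(** The ring [R] has the basis [1, x, x(x - alpha)] over the localization of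
    the integers at [p], so every submodule of finite index is spanned by the
    rows [(p^a, u, v)], [(0, p^b, w)], [(0, 0, p^c)] of a unique Hermite normal
    form with [0 <= u < p^b] and [0 <= v, w < p^c]; its index is [p^(a+b+c)].
    Being stable under multiplication by [x] amounts to three divisibilities
    between integers.  Under the assumption on the valuations the number of
    solutions [(w, u, v)] of these is a polynomial in [p] that depends on
    [a, b, c] only through the conditions [a >= 1], [a >= 2] and the values
    [b = 0], [1], [2], [>= 3] and [c = 0], [1], [2], [>= 3], so that the triple
    generating series is a combination of products of geometric series. *)
Require Import Defs.
From mathcomp Require Import finmap boolp classical_sets cardinality.
From mathcomp Require Import all_boot all_order all_algebra zify ring.

Set Implicit Arguments.
Unset Strict Implicit.
Unset Printing Implicit Defensive.
Import Order.TTheory GRing.Theory Num.Theory.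
Local Open Scope ring_scope.

(** * Linear congruences modulo prime powers *)

Lemma dvdzDr (d m n : int) : (d %| n)%Z -> (d %| m + n)%Z = (d %| m)%Z.
Proof. exact: rpredDr. Qed.

Lemma dvdzDl (d m n : int) : (d %| m)%Z -> (d %| m + n)%Z = (d %| n)%Z.
Proof. exact: rpredDl. Qed.

Lemma dvdzN (d m : int) : (d %| - m)%Z = (d %| m)%Z.
Proof. exact: rpredN. Qed.

(** As [c] is invertible modulo [n], the condition fixes [v] modulo [n]; the root [r] has exactly
    the [d] lifts [r + j * n] below [d * n]. *)
Lemma card_affine_residue (N n d : nat) (e c : int) :
  N = (d * n)%N -> (0 < n)%N -> coprimez n c ->
  #|[set v : 'I_N | (n %| e + c * (v : nat)%:Z)%Z]| = d.
Proof.
move=> -> n_gt0 co_nc; have n_gt0' : 0 < n%:Z by [].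
have [[y x] /= bez] := coprimezP _ _ co_nc.
pose r := `|((- (e * x)) %% n)%Z|%N.
have rE : (r%:Z = (- (e * x)) %% n)%Z by rewrite /r gez0_abs // modz_ge0 // lt0r_neq0.
have r_lt : (r < n)%N by rewrite -ltz_nat rE ltz_pmod.
have lt_f (j : 'I_d) : (r + j * n < d * n)%N by have := ltn_ord j; nia.
pose f j := Ordinal (lt_f j).
have f_inj : injective f.
  move=> i j /(congr1 val) /= /eqP; rewrite eqn_add2l eqn_pmul2r // => /eqP.
  exact: val_inj.
rewrite -[RHS](card_ord d) -(card_imset predT f_inj) /=.
have -> // : [set v : 'I_(d * n) | (n %| e + c * (v : nat)%:Z)%Z] = f @: predT.
apply/setP=> v; rewrite inE.
have -> : (n %| e + c * (v : nat)%:Z)%Z = (v == r %[mod n])%N.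
  have -> : e + c * v%:Z = c * (v%:Z + e * x) + n%:Z * (e * y).
    by rewrite -{1}[e]mulr1 -bez; ring.
  rewrite (dvdzDr _ (dvdz_mulr _ (dvdzz _))) Gauss_dvdzr //.
  rewrite -[in LHS](opprK (e * x)) -eqz_mod_dvd -rE modz_nat eqz_nat.
  by rewrite (modn_small r_lt).
apply/eqP/imsetP => [vr | [j _ ->]] /=; last by rewrite addnC modnMDl.
have lt_j : (v %/ n < d)%N by rewrite ltn_divLR.
exists (Ordinal lt_j) => //; apply: val_inj => /=.
by rewrite {1}(divn_eq v n) vr (modn_small r_lt) addnC.
Qed.

Lemma PoszX (p n : nat) : (p ^ n)%N%:Z = p%:Z ^+ n.
Proof. by rewrite -[LHS]natz natrX natz. Qed.

(** If [n <= m], the term in [v] vanishes modulo [p^n], so all residues qualify or none. Otherwise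
    [p^m] must divide [e]; dividing by it leaves a congruence modulo [p^(n-m)] with unit
    coefficient, whose root has [p^m] lifts. *)
Lemma card_linear_congruence (p n m : nat) (e d : int) :
  prime p -> coprimez p d ->
  #|[set v : 'I_(p ^ n) | (p%:Z ^+ n %| e + p%:Z ^+ m * d * (v : nat)%:Z)%Z]| =
  if (p%:Z ^+ minn m n %| e)%Z then (p ^ minn m n)%N else 0%N.
Proof.
move=> p_pr co_pd; have p_neq0 : p%:Z != 0 by rewrite eqz_nat -lt0n prime_gt0.
have [le_nm | /ltnW le_mn] := leqP n m.
  rewrite [LHS](_ : _ = #|[set v : 'I_(p ^ n) | (p%:Z ^+ n %| e)%Z]|).
    case: ifP => _; first by rewrite cardsT card_ord.
    by rewrite (_ : [set v | false] = set0) ?cards0 //; apply/setP=> v; rewrite !inE.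
  apply: eq_card => v; rewrite !inE dvdzDr // -mulrA dvdz_mulr //.
  exact: dvdz_exp2l.
have pnE : p%:Z ^+ n = p%:Z ^+ m * p%:Z ^+ (n - m) by rewrite -exprD subnKC.
case: ifP => [/dvdzP[e' ->] | not_dvd].
  rewrite -(@card_affine_residue (p ^ n) (p ^ (n - m)) (p ^ m) e' d).
  - apply: eq_card => v; rewrite !inE pnE mulrC -mulrA -mulrDr.
    by rewrite dvdz_mul2l ?expf_neq0 // PoszX.
  - by rewrite -expnD subnKC.
  - by rewrite expn_gt0 prime_gt0.
  by rewrite PoszX coprimezXl.
apply: eq_card0 => v; rewrite !inE; apply/negbTE; apply: contraFN not_dvd => dvd_n.
rewrite -(@dvdzDr _ _ (p%:Z ^+ m * d * v%:Z)) -?mulrA ?dvdz_mulr ?dvdzz //.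
by rewrite mulrA (dvdz_trans _ dvd_n) // dvdz_exp2l.
Qed.

Lemma card_unit_congruence (p n : nat) (e d : int) : prime p -> coprimez p d ->
  #|[set v : 'I_(p ^ n) | (p%:Z ^+ n %| e + d * (v : nat)%:Z)%Z]| = 1%N.
Proof.
move=> p_pr co_pd; rewrite -(@card_affine_residue (p ^ n) (p ^ n) 1 e d) ?mul1n //.
- by apply: eq_card => v; rewrite !inE PoszX.
- by rewrite expn_gt0 prime_gt0.
by rewrite PoszX coprimezXl.
Qed.

(** * The generating series *)

(* The number of stable Hermite normal forms with diagonal p^a, p^b, p^c when
   q = p, see card_hnf_setE. *)
Definition hnf_count (q : int) (a b c : nat) : int :=
  (c == 0%N)%:R * (b == 0%N)%:R
  + (c == 0%N)%:R * (0 < b)%N%:R * (q * (0 < a)%N%:R)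
  + (c == 1%N)%:R * (0 < b)%N%:R
    * (q * (q - 1) * (0 < a)%N%:R + q ^+ 2 * (1 < a)%N%:R)
  + (c == 2%N)%:R * (1 < b)%N%:R
    * (q ^+ 2 * (q - 1) * (0 < a)%N%:R + q ^+ 3 * (1 < a)%N%:R)
  + (2 < c)%N%:R * (b == 2%N)%:R * (q ^+ 3 * (0 < a)%N%:R)
  + (2 < c)%N%:R * (2 < b)%N%:R * (q ^+ 4 * (1 < a)%N%:R).

(** Truncation replaces power series by polynomials, at the cost of error terms divisible by
    ['X^n]. *)
Definition truncated_series (n : nat) (f : nat -> int) : {poly int} :=
  \sum_(i < n) f i *: 'X^i.

Lemma truncated_seriesD n f g :
  truncated_series n (fun i => f i + g i) = truncated_series n f + truncated_series n g.
Proof. by rewrite -big_split; apply: eq_bigr => i _; rewrite scalerDl. Qed.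

Lemma truncated_seriesZ n k f :
  truncated_series n (fun i => k * f i) = k *: truncated_series n f.
Proof. by rewrite scaler_sumr; apply: eq_bigr => i _; rewrite scalerA. Qed.

Lemma truncated_series_delta n j : (j < n)%N ->
  truncated_series n (fun i => (i == j)%:R) = 'X^j.
Proof.
move=> j_lt; rewrite /truncated_series (bigD1 (Ordinal j_lt)) //= eqxx scale1r.
by rewrite big1 ?addr0 // => i /negbTE ij; rewrite -val_eqE /= in ij; rewrite ij scale0r.
Qed.

Lemma truncated_series_ge n j : (j <= n)%N ->
  (1 - 'X) * truncated_series n (fun i => (j <= i)%N%:R) = 'X^j - 'X^n.
Proof.
move=> /subnKC <-; elim: (n - j)%N => [|m IHm].
  rewrite addn0 subrr /truncated_series big1 ?mulr0 // => i _.
  by rewrite leqNgt ltn_ord scale0r.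
rewrite addnS /truncated_series big_ord_recr /= mulrDr IHm leq_addr scale1r exprS.
ring.
Qed.

Lemma truncated_series_mul3 n (f g h : nat -> int) :
  \sum_(a < n) \sum_(b < n) \sum_(c < n) (h c * g b * f a) *: 'X^(a + b + c)
  = truncated_series n h * truncated_series n g * truncated_series n f.
Proof.
rewrite [RHS]mulrC [X in _ = _ * X]mulrC /truncated_series big_distrl.
apply: eq_bigr => a _; rewrite big_distrl /= mulr_sumr.
apply: eq_bigr => b _; rewrite !mulr_sumr; apply: eq_bigr => c _ /=.
rewrite -!mul_polyC !polyCM !exprD.
ring.
Qed.

(** For [k < n] the coefficient of ['X^k] is complete, because [a + b + c = k] keeps all three
    exponents below [n]. *)
Definition hnf_gf (q : int) (n : nat) : {poly int} :=
  \sum_(a < n) \sum_(b < n) \sum_(c < n) hnf_count q a b c *: 'X^(a + b + c).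

(** Each summand of [hnf_count] is a product of functions of [c], [b] and [a] alone, so its triple
    sum factors; [d j] stands for a monomial, [g j] for a geometric series. *)
Lemma hnf_gf_split q n : hnf_gf q n =
  let S := truncated_series n in
  let d j := S (fun i => (i == j)%:R) in
  let g j := S (fun i => (j <= i)%N%:R) in
  d 0%N * d 0%N * g 0%N + d 0%N * g 1%N * (q *: g 1%N)
  + d 1%N * g 1%N * ((q * (q - 1)) *: g 1%N + (q ^+ 2) *: g 2%N)
  + d 2%N * g 2%N * ((q ^+ 2 * (q - 1)) *: g 1%N + (q ^+ 3) *: g 2%N)
  + g 3%N * d 2%N * (q ^+ 3 *: g 1%N) + g 3%N * g 3%N * (q ^+ 4 *: g 2%N).
Proof.
cbv zeta.
rewrite -!truncated_seriesZ -!truncated_seriesD -!truncated_series_mul3.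
rewrite -!big_split; apply: eq_bigr => a _; rewrite -!big_split.
apply: eq_bigr => b _; rewrite -!big_split; apply: eq_bigr => c _ /=.
by rewrite -!scalerDl /hnf_count mulr1.
Qed.

Lemma hnf_gf_numerator (q : int) n : (3 < n)%N -> exists E : {poly int},
  (1 - 'X) ^+ 3 * hnf_gf q n =
  (q ^+ 4) *: 'X^8 - (2 * q ^+ 3) *: 'X^7 + (q ^+ 3 + q ^+ 2) *: 'X^6
     + (q ^+ 3 - 2 * q ^+ 2) *: 'X^5 + q *: 'X^4 + (q ^+ 2 - 2 * q) *: 'X^3
     + (q + 1) *: 'X^2 - 2 *: 'X + 1 + E * 'X^n.
Proof.
move=> n_gt3; rewrite hnf_gf_split /=.
rewrite !truncated_series_delta; try lia.
have g j : (j < 4)%N ->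
    (1 - 'X) * truncated_series n (fun i => (j <= i)%N%:R) = 'X^j - 'X^n.
  by move=> j_lt; apply: truncated_series_ge; lia.
move: (g 0 isT) (g 1 isT) (g 2 isT) (g 3 isT).
set g0 := truncated_series _ _; set g1 := truncated_series _ _.
set g2 := truncated_series _ _; set g3 := truncated_series _ _.
rewrite -!mul_polyC !(polyCD, polyCM, polyCN, polyCB, polyC_exp).
set Q := q%:P; set Y : {poly int} := 'X^n; set X : {poly int} := 'X => e0 e1 e2 e3.
(* Chosen so that [(X^i - Y) * (X^j - Y) = X^(i+j) + Y * r i j]. *)
pose r i j := Y - X ^+ i - X ^+ j.
exists (- (1 - X) ^+ 2 + (1 - X) * (Q * r 1%N 1%N
  + X * (Q * (Q - 1) * r 1%N 1%N + Q ^+ 2 * r 1%N 2%N)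
  + X ^+ 2 * (Q ^+ 2 * (Q - 1) * r 1%N 2%N + Q ^+ 3 * r 2%N 2%N + Q ^+ 3 * r 1%N 3%N))
  + Q ^+ 4 * ((X ^+ 2 - Y) * r 3%N 3%N - X ^+ 6)).
(* Each geometric series receives one factor [1 - X]; summands with fewer than three such series
   keep the remaining factors. *)
transitivity ((1 - X) ^+ 2 * ((1 - X) * g0)
  + (1 - X) * (Q * ((1 - X) * g1) ^+ 2
    + X * ((1 - X) * g1) * (Q * (Q - 1) * ((1 - X) * g1) + Q ^+ 2 * ((1 - X) * g2))
    + X ^+ 2 * ((1 - X) * g2)
      * (Q ^+ 2 * (Q - 1) * ((1 - X) * g1) + Q ^+ 3 * ((1 - X) * g2))
    + X ^+ 2 * Q ^+ 3 * ((1 - X) * g1) * ((1 - X) * g3))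
  + Q ^+ 4 * ((1 - X) * g2) * ((1 - X) * g3) ^+ 2).
  by rewrite polyC1; ring.
rewrite e0 e1 e2 e3 polyC1 /r; ring.
Qed.

Lemma coef_hnf_gf q n k : (hnf_gf q n)`_k =
  \sum_(a < n) \sum_(b < n) \sum_(c < n | (a + b + c == k)%N) hnf_count q a b c.
Proof.
rewrite coef_sum; apply: eq_bigr => a _; rewrite coef_sum; apply: eq_bigr => b _.
rewrite coef_sum [RHS]big_mkcond; apply: eq_bigr => c _ /=.
by rewrite coefZ coefXn eq_sym; case: eqP => _; rewrite ?mulr1 ?mulr0.
Qed.

Lemma fps_mul_polyE (P G : {poly int}) (F : fps) k :
  (forall i, (i <= k)%N -> F i = G`_i) -> fps_mul (fps_of_poly P) F k = (P * G)`_k.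
Proof.
by move=> FG; rewrite coefM; apply: eq_bigr => i _; rewrite FG ?leq_subr.
Qed.

(** * Counting stable Hermite normal forms *)

(* With e0 = 1, e1 = x and e2 = x(x - alpha), multiplication by x maps e0, e1, e2
   to e1, alpha e1 + e2, beta e2; reducing x times the rows (p^a, u, v) and
   (0, p^b, w) by the rows below them gives these divisibilities. *)
Definition hnf_stable (p : nat) (alpha beta : int) (a b c : nat)
    (w u v : int) : bool :=
  let x := p%:Z ^+ a + alpha * u in
  [&& (p%:Z ^+ b %| x)%Z, (p%:Z ^+ c %| p%:Z ^+ b + (beta - alpha) * w)%Z
    & (p%:Z ^+ c %| u + beta * v - w * (x %/ p%:Z ^+ b)%Z)%Z].

(** Triples are ordered [(w, u, v)]: only the third divisibility involves [v], which is therefore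
    counted innermost. *)
Definition hnf_set (p : nat) (alpha beta : int) (a b c : nat) :
    {set 'I_(p ^ c) * 'I_(p ^ b) * 'I_(p ^ c)} :=
  [set t : 'I_(p ^ c) * 'I_(p ^ b) * 'I_(p ^ c) | hnf_stable p alpha beta a b c
             (t.1.1 : nat)%:Z (t.1.2 : nat)%:Z (t.2 : nat)%:Z].

(** * Counts for [alpha = p d1], [beta = p d2], [beta - alpha = p^2 g] with [d1], [d2], [g] prime to
    [p] *)

Section Count.

Variables (p : nat) (p_pr : prime p) (d1 d2 g : int).
Hypotheses (co1 : coprimez p d1) (co2 : coprimez p d2) (cog : coprimez p g).
Hypothesis diffE : p%:Z * d2 - p%:Z * d1 = p%:Z ^+ 2 * g.

Let P_neq0 : p%:Z != 0. Proof. by rewrite eqz_nat -lt0n prime_gt0. Qed.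

Let dvdPX m n : (p%:Z ^+ m %| p%:Z ^+ n)%Z = (m <= n)%N.
Proof. by rewrite dvdz_Pexp2l // ltz_nat prime_gt1. Qed.

Let coprimePX n d : coprimez p d -> coprimez (p%:Z ^+ n) d.
Proof. exact: coprimezXl. Qed.

Let coprimeP d : coprimez p d = ~~ (p%:Z %| d)%Z.
Proof. by rewrite coprimezE dvdzE prime_coprime. Qed.

(** The first two conditions of [hnf_stable], and the quotient that enters the third. *)
Let row1 (a b : nat) (u : int) := (p%:Z ^+ b %| p%:Z ^+ a + p%:Z * d1 * u)%Z.
Let row2 (b c : nat) (w : int) := (p%:Z ^+ c %| p%:Z ^+ b + p%:Z ^+ 2 * g * w)%Z.
Let quo (a b : nat) (u : int) := ((p%:Z ^+ a + p%:Z * d1 * u) %/ p%:Z ^+ b)%Z.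

Lemma card_row1 a b : #|[set u : 'I_(p ^ b) | row1 a b (u : nat)%:Z]| =
  if (p%:Z ^+ minn 1 b %| p%:Z ^+ a)%Z then (p ^ minn 1 b)%N else 0%N.
Proof. exact: (@card_linear_congruence p b 1 (p%:Z ^+ a) d1 p_pr co1). Qed.

Lemma card_row2 b c : #|[set w : 'I_(p ^ c) | row2 b c (w : nat)%:Z]| =
  if (p%:Z ^+ minn 2 c %| p%:Z ^+ b)%Z then (p ^ minn 2 c)%N else 0%N.
Proof. exact: (@card_linear_congruence p c 2 (p%:Z ^+ b) g p_pr cog). Qed.

(** For [c >= 1] the third condition is a congruence in [v] with coefficient [p d2]; it is solvable
    exactly when [p] divides [u - w * quo a b u]. *)
Definition row1_count (a b : nat) (w : int) : nat :=
  #|[set u : 'I_(p ^ b) | row1 a b (u : nat)%:Z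
      && (p%:Z %| (u : nat)%:Z - w * quo a b (u : nat)%:Z)%Z]|.

Lemma card_hnf_set_c0 a b : #|hnf_set p (p%:Z * d1) (p%:Z * d2) a b 0| =
  if (p%:Z ^+ minn 1 b %| p%:Z ^+ a)%Z then (p ^ minn 1 b)%N else 0%N.
Proof.
rewrite -card_row1.
pose z : 'I_(p ^ 0) := Ordinal (ltnSn 0).
have f_inj : injective (fun u : 'I_(p ^ b) => (z, u, z)) by move=> u v [].
rewrite -(card_imset _ f_inj); apply: eq_card => -[[w u] v].
rewrite inE /hnf_stable /= expr0 !dvd1z /= andbT.
have ord1p (i : 'I_(p ^ 0)) : i = z.
  by apply: val_inj => /=; case: i => i /=; rewrite expn0 ltnS leqn0 => /eqP.
apply/idP/imsetP => [row_u | [u' row_u [_ -> _]]]; last by rewrite inE in row_u.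
by exists u; rewrite ?inE ?(ord1p w) ?(ord1p v).
Qed.

(** Each admissible pair [(w, u)] has exactly [p] completions [v], since the coefficient of [v] is
    [p] times a unit. *)
Lemma card_hnf_setS a b c :
  #|hnf_set p (p%:Z * d1) (p%:Z * d2) a b c.+1| =
  (p * \sum_(w : 'I_(p ^ c.+1) | row2 b c.+1 (w : nat)%:Z)
         row1_count a b (w : nat)%:Z)%N.
Proof.
rewrite -sum1_card big_distrr /=.
rewrite (eq_bigl (fun t : 'I_(p ^ c.+1) * 'I_(p ^ b) * 'I_(p ^ c.+1) =>
   (row2 b c.+1 (t.1.1 : nat)%:Z
     && row1 a b (t.1.2 : nat)%:Z) &&
   (p%:Z ^+ c.+1 %| (t.1.2 : nat)%:Z - (t.1.1 : nat)%:Z * quo a b (t.1.2 : nat)%:Z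
     + p%:Z ^+ 1 * d2 * (t.2 : nat)%:Z)%Z)); last first.
  move=> [[w u] v]; rewrite inE /hnf_stable /= diffE andbA [in RHS](andbC (row2 _ _ _)).
  by rewrite expr1 [in RHS]addrAC.
rewrite -(pair_big_dep (fun s : 'I_(p ^ c.+1) * 'I_(p ^ b) =>
    row2 b c.+1 (s.1 : nat)%:Z && row1 a b (s.2 : nat)%:Z)
  (fun s (v : 'I_(p ^ c.+1)) => (p%:Z ^+ c.+1 %|
     (s.2 : nat)%:Z - (s.1 : nat)%:Z * quo a b (s.2 : nat)%:Z
     + p%:Z ^+ 1 * d2 * (v : nat)%:Z)%Z) (fun _ _ => 1%N)) /=.
rewrite -(pair_big_dep (fun w : 'I_(p ^ c.+1) => row2 b c.+1 (w : nat)%:Z)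
  (fun w (u : 'I_(p ^ b)) => row1 a b (u : nat)%:Z) (fun w u => \sum_(v : 'I_(p ^ c.+1) |
   (p%:Z ^+ c.+1 %| (u : nat)%:Z - (w : nat)%:Z * quo a b (u : nat)%:Z
     + p%:Z ^+ 1 * d2 * (v : nat)%:Z)%Z) 1%N)) /=.
apply: eq_bigr => w _; rewrite /row1_count -sum1dep_card big_distrr /= big_mkcondr /=.
apply: eq_bigr => u _; rewrite sum1dep_card card_linear_congruence //.
by rewrite minnSS min0n expr1 expn1 muln1.
Qed.

(** The extra condition becomes [p | u]. As [b >= 2], [row1] gives [p^2 | p^a + p d1 u]: this forces
    [p | u] if [a >= 2] and excludes it if [a = 1]. *)
Lemma row1_count_dvd a b w : (0 < a)%N -> (1 < b)%N -> (p%:Z %| w)%Z ->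
  row1_count a b w = if (1 < a)%N then p else 0%N.
Proof.
move=> a_gt0 b_gt1 p_w.
transitivity #|[set u : 'I_(p ^ b) | row1 a b (u : nat)%:Z && (p%:Z %| (u : nat)%:Z)%Z]|.
  apply: eq_card => u; rewrite !inE; congr (_ && _).
  by rewrite dvdzDr // dvdzN dvdz_mulr.
have [b2 p2] : (p%:Z ^+ 2 %| p%:Z ^+ b)%Z /\ forall u, row1 a b u ->
    (p%:Z ^+ 2 %| p%:Z ^+ a + p%:Z * (d1 * u))%Z.
  rewrite dvdPX; split => // u; rewrite /row1 -mulrA; apply: dvdz_trans.
  by rewrite dvdPX.
case: ifP => a_gt1.
  transitivity #|[set u : 'I_(p ^ b) | row1 a b (u : nat)%:Z]|.
    apply: eq_card => u; rewrite !inE; apply: andb_idr => /p2.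
    rewrite addrC dvdzDr ?dvdPX // expr2 dvdz_mul2l // Gauss_dvdzr //.
  rewrite card_row1 (minn_idPl _) 1?ltnW // dvdPX a_gt0 expn1 //.
apply: eq_card0 => u; rewrite !inE; apply/negP => /andP[/p2 + p_u].
have -> : a = 1%N by lia.
rewrite dvdzDr; last by rewrite expr2 dvdz_mul ?dvdz_mull.
by rewrite dvdPX.
Qed.

(* Given the first divisibility, the second one reads p^(b+1) | p^b u - w X with
   X = p^a + p d1 u; as w is a unit this implies p^b | X, so the two merge. *)
Lemma row1_count_ndvd a b w : (0 < a)%N -> (0 < b)%N -> ~~ (p%:Z %| w)%Z ->
  row1_count a b w = #|[set u : 'I_(p ^ b) |
    (p%:Z ^+ b %| - (w * p%:Z ^+ a.-1)
       + (p%:Z ^+ b.-1 - w * d1) * (u : nat)%:Z)%Z]|.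
Proof.
case: a b => // a [//|b] _ _; rewrite -coprimeP => co_w.
apply: eq_card => u; rewrite !inE /row1 /quo /=.
set X := _ ^+ _ + _.
have XE : p%:Z * (- (w * p%:Z ^+ a) + (p%:Z ^+ b - w * d1) * (u : nat)%:Z) =
    p%:Z ^+ b.+1 * (u : nat)%:Z - w * X by rewrite /X !exprS; ring.
rewrite -[RHS](@dvdz_mul2l p%:Z) // XE -exprS.
have [/dvdzP[k ->] | not_dvd] /= := boolP (p%:Z ^+ b.+1 %| X)%Z.
  rewrite mulzK ?expf_neq0 // mulrA [_ * _ in RHS]mulrC -mulrBl.
  by rewrite dvdz_mul2r ?expf_neq0.
apply/esym/negbTE; apply: contra not_dvd => dvd_X.
rewrite -(@Gauss_dvdzr _ w) ?coprimePX // -dvdzN.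
rewrite -(@dvdzDl _ (p%:Z ^+ b.+1 * (u : nat)%:Z)) ?dvdz_mulr ?dvdzz //.
by apply: dvdz_trans dvd_X; rewrite exprS dvdz_mull.
Qed.

(** For [b >= 2] the coefficient [p^(b-1) - w d1] of the merged congruence is a unit. *)
Lemma row1_count_unit a b w : (0 < a)%N -> (1 < b)%N -> ~~ (p%:Z %| w)%Z ->
  row1_count a b w = 1%N.
Proof.
case: b => // b a_gt0 b_gt0 ndvd_w; rewrite row1_count_ndvd //.
apply: card_unit_congruence => //; rewrite coprimeP dvdzDl.
  by rewrite dvdzN -coprimeP coprimezMr co1 andbT coprimeP.
by rewrite dvdz_exp ?dvdzz.
Qed.

(** The merged congruence now has coefficient [1 - w d1]. If [p] divides it, the constant term
    [- w p^(a-1)] decides between all residues and none. If [p | w], the extra condition alone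
    forces [u = 0]. *)
Lemma row1_count_b1 a w : (0 < a)%N -> row1_count a 1 w =
  if (p%:Z %| 1 - w * d1)%Z then if (1 < a)%N then p else 0%N else 1%N.
Proof.
move=> a_gt0; have [p_w | ndvd_w] := boolP (p%:Z %| w)%Z.
  rewrite ifN; last first.
    rewrite dvdzDr ?dvdzN ?dvdz_mulr // dvdz1 /=.
    by rewrite gtn_eqF ?prime_gt1.
  rewrite -[RHS](@card_unit_congruence p 1 0 1 p_pr) /coprimez ?gcdz1 //.
  apply: eq_card => u; rewrite !inE add0r mul1r expr1.
  have -> /= : row1 a 1 (u : nat)%:Z.
    rewrite /row1 expr1 dvdzDl ?dvdz_exp ?dvdzz //.
    by rewrite -mulrA dvdz_mulr ?dvdzz.
  by rewrite dvdzDr // dvdzN dvdz_mulr.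
rewrite row1_count_ndvd //= expr0 expr1.
case: ifP => [p_dvd | /negbT]; last first.
  by rewrite -coprimeP => co; apply: (@card_unit_congruence p 1).
transitivity #|[set u : 'I_(p ^ 1) | (1 < a)%N]|.
  apply: eq_card => u; rewrite !inE dvdzDr ?dvdz_mulr // dvdzN.
  rewrite Gauss_dvdzr ?coprimeP //.
  by rewrite -[p%:Z in LHS]expr1 dvdPX; lia.
case: ifP => _; first by rewrite cardsT card_ord expn1.
by apply: eq_card0 => u; rewrite !inE.
Qed.

Lemma card_dvd_ord c : #|[set w : 'I_(p ^ c.+1) | (p%:Z %| (w : nat)%:Z)%Z]| = (p ^ c)%N.
Proof.
rewrite -(@card_affine_residue (p ^ c.+1) p (p ^ c) 0 1) ?expnSr ?prime_gt0 //.
  by apply: eq_card => w; rewrite !inE add0r mul1r.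
by rewrite /coprimez gcdz1.
Qed.

(** The first condition would make [p] divide [1 + p d1 u]. *)
Lemma card_hnf_set_a0 b c :
  #|hnf_set p (p%:Z * d1) (p%:Z * d2) 0 b.+1 c| = 0%N.
Proof.
case: c => [|c]; first by rewrite card_hnf_set_c0 minnSS min0n dvdPX.
rewrite card_hnf_setS big1 ?muln0 // => w _; apply: eq_card0 => u.
rewrite !inE; apply/negbTE; rewrite negb_and; apply/orP; left.
apply: contraTN isT => row_u.
have: (p%:Z ^+ 1 %| p%:Z ^+ 0 + p%:Z * d1 * (u : nat)%:Z)%Z.
  by apply: dvdz_trans row_u; rewrite dvdPX.
by rewrite dvdzDr ?dvdPX // expr1 -mulrA dvdz_mulr ?dvdzz.
Qed.

Lemma card_hnf_set_row2 a b c : (b < 2)%N -> (b < c)%N ->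
  #|hnf_set p (p%:Z * d1) (p%:Z * d2) a b c| = 0%N.
Proof.
case: c => // c b_lt2 b_ltc; rewrite card_hnf_setS big_pred0 ?muln0 // => w.
have := card_row2 b c.+1; rewrite dvdPX leqNgt leq_min b_lt2 b_ltc /=.
by move/eqP; rewrite cards_eq0 => /eqP/setP/(_ w); rewrite !inE.
Qed.

(** Every [w] satisfies [row2]; the single residue with [w d1 = 1] modulo [p] contributes [p] or 0,
    each of the other [p - 1] contributes 1. *)
Lemma card_hnf_set_b1c1 a : (0 < a)%N ->
  #|hnf_set p (p%:Z * d1) (p%:Z * d2) a 1 1| =
  (p * (p.-1 + if (1 < a)%N then p else 0))%N.
Proof.
move=> a_gt0; rewrite card_hnf_setS; congr (p * _)%N.
rewrite (eq_bigl predT) => [|w]; last first.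
  by rewrite /row2 dvdzDr ?dvdPX // -mulrA dvdz_mulr // dvdPX.
rewrite (eq_bigr (fun w : 'I_(p ^ 1) => if (p%:Z %| 1 - (w : nat)%:Z * d1)%Z
  then if (1 < a)%N then p else 0%N else 1%N)); last first.
  by move=> w _; rewrite row1_count_b1.
rewrite (bigID (fun w : 'I_(p ^ 1) => (p%:Z %| 1 - (w : nat)%:Z * d1)%Z)) /=.
have card1 : #|[pred w : 'I_(p ^ 1) | (p%:Z %| 1 - (w : nat)%:Z * d1)%Z]| = 1%N.
  rewrite -[RHS](@card_unit_congruence p 1 1 (- d1) p_pr) ?coprimezN //.
  by apply: eq_card => w; rewrite !inE expr1 mulNr mulrC.
rewrite (eq_bigr (fun=> if (1 < a)%N then p else 0%N)); last by move=> w ->.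
rewrite sum_nat_const card1 mul1n addnC; congr (_ + _)%N.
rewrite (eq_bigr (fun=> 1%N)); last by move=> w /negbTE ->.
rewrite sum1_card.
have cC := cardC [pred w : 'I_(p ^ 1) | (p%:Z %| 1 - (w : nat)%:Z * d1)%Z].
rewrite card1 card_ord [RHS]expn1 add1n in cC; rewrite -[X in X.-1]cC /=.
by apply: eq_card => w; rewrite !inE.
Qed.

(** Here [m] counts the solutions [w] of [row2] divisible by [p]. For exponent [c + 1 <= 2] every
    [w] is a solution. Beyond that, [row2] implies [p^3 | p^b + p^2 g w], which makes [w] a unit if
    [b = 2] and a multiple of [p] if [b >= 3]. *)
Lemma card_hnf_set_b2 a b c : (0 < a)%N -> (1 < b)%N ->
  #|hnf_set p (p%:Z * d1) (p%:Z * d2) a b c.+1| =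
  let m := if (c < 2)%N then (p ^ c)%N else if b == 2 then 0%N else (p ^ 2)%N in
  (p * (m * (if (1 < a)%N then p else 0) + (p ^ minn 2 c.+1 - m)))%N.
Proof.
move=> a_gt0 b_gt1; rewrite card_hnf_setS.
set m := if (c < 2)%N then _ else _; congr (p * _)%N.
pose D (w : 'I_(p ^ c.+1)) := (p%:Z %| (w : nat)%:Z)%Z.
pose row (w : 'I_(p ^ c.+1)) := row2 b c.+1 (w : nat)%:Z.
have card_row : #|row| = (p ^ minn 2 c.+1)%N.
  have := card_row2 b c.+1; rewrite dvdPX.
  rewrite (leq_trans (geq_minl _ _)) // => <-.
  by apply: eq_card => w; rewrite !inE.
have card_rowD : #|[pred w | row w & D w]| = m.
  rewrite /m; case: ltnP => [c_lt2 | c_ge2].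
    rewrite -[RHS]card_dvd_ord; apply: eq_card => w; rewrite !inE; apply: andb_idl => _.
    rewrite /row /row2 dvdzDr ?dvdPX ?(leq_trans c_lt2) //.
    by rewrite -mulrA dvdz_mulr // dvdPX.
  have dvd3 w : row w -> (p%:Z ^+ 3 %| p%:Z ^+ b + p%:Z ^+ 2 * g * (w : nat)%:Z)%Z.
    by apply: dvdz_trans; rewrite dvdPX.
  case: eqP => [b2 | /eqP b_neq2].
    apply: eq_card0 => w; rewrite !inE; apply/negP => /andP[/dvd3 + D_w].
    rewrite b2 dvdzDr ?dvdPX // -mulrA [_ ^+ 3]exprSr dvdz_mul ?dvdzz //.
    by rewrite dvdz_mull.
  have -> : (p ^ 2 = p ^ minn 2 c.+1)%N by rewrite (minn_idPl _) // ltnW.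
  rewrite -card_row; apply: eq_card => w; rewrite !inE; apply: andb_idr => /dvd3.
  rewrite dvdzDl ?dvdPX; last by lia.
  by rewrite -mulrA [_ ^+ 3]exprSr dvdz_mul2l ?expf_neq0 // Gauss_dvdzr.
rewrite (bigID D) /=; congr (_ + _)%N.
  rewrite -{}card_rowD -sum_nat_const; apply: eq_bigr => w /andP[_ D_w].
  exact: row1_count_dvd.
rewrite (eq_bigr (fun=> 1%N)) => [|w /andP[_ nD_w]]; last exact: row1_count_unit.
rewrite sum1_card -card_row -card_rowD -[#|row|](cardID D).
by rewrite -[LHS](addKn #|[predI row & D]|); congr (_ + _ - _)%N;
  apply: eq_card => w; rewrite !inE // andbC.
Qed.

Lemma card_hnf_setE a b c :
  #|hnf_set p (p%:Z * d1) (p%:Z * d2) a b c|%:Z = hnf_count p%:Z a b c.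
Proof.
have p_gt0 := prime_gt0 p_pr.
have predE : p.-1%:Z = p%:Z - 1 by rewrite -subn1 -subzn.
have p2E : (p ^ 2 - p)%N%:Z = p%:Z ^+ 2 - p%:Z.
  by rewrite -subzn ?PoszX // -{1}[p]expn1 leq_pexp2l.
rewrite /hnf_count; case: c => [|c].
  rewrite card_hnf_set_c0 dvdPX.
  by case: b => [|b]; case: a => [|a]; rewrite ?minnSS ?min0n ?minn0 ?expn1 /=; ring.
case: b => [|[|b]].
- by rewrite card_hnf_set_row2 //; case: c => [|[|c]] /=; ring.
- case: a => [|a]; first by rewrite card_hnf_set_a0; case: c => [|[|c]] /=; ring.
  case: c => [|c]; last by rewrite card_hnf_set_row2 //; case: c => [|c] /=; ring.
  rewrite card_hnf_set_b1c1 // PoszM PoszD predE.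
  by case: a => [|a] /=; ring.
case: a => [|a]; first by rewrite card_hnf_set_a0; case: c => [|[|c]] /=; ring.
rewrite card_hnf_set_b2 // PoszM PoszD PoszM.
case: c => [|[|c]] /=.
- by rewrite expn0 expn1 subn1 predE; case: a => [|a] /=; ring.
- by rewrite expn1 p2E; case: a => [|a] /=; ring.
by case: b => [|b] /=; rewrite ?subn0 ?subnn PoszX; case: a => [|a] /=; ring.
Qed.

End Count.

(** * The localization of the integers at a prime *)

Section Zloc.

Variables (p : nat) (p_pr : prime p).
Local Notation A := (Zloc p_pr).
Implicit Types (x y : A) (m n : nat).

Let p_neq0 : p%:Z != 0. Proof. by rewrite eqz_nat -lt0n prime_gt0. Qed.

Lemma Zloc_fracP x : exists a b : int, coprimez p b /\ x * b%:~R = a%:~R.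
Proof.
case: x => r r_in; case/asboolP: (r_in) => a [b [ndvd rE]]; exists a, b; split.
  by rewrite coprimezE prime_coprime.
apply: val_inj; rewrite rmorphM !rmorph_int /= rE divfK // intr_eq0.
by apply: contraNneq ndvd => ->; rewrite dvdz0.
Qed.

Lemma Zloc_int_inj (a b : int) : a%:~R = b%:~R :> A -> a = b.
Proof. by move/(congr1 val); rewrite !rmorph_int => /intr_inj. Qed.

Lemma Zloc_int_unit (b : int) : coprimez p b -> exists y : A, b%:~R * y = 1.
Proof.
move=> co_pb.
have ndvd : ~~ (p%:Z %| b)%Z by rewrite dvdzE -prime_coprime.
have b_neq0 : b%:~R != 0 :> rat.
  by rewrite intr_eq0; apply: contraNneq ndvd => ->; rewrite dvdz0.
have y_in : (1%:~R / b%:~R : rat) \in Zloc_pred p_pr by apply/asboolP; exists 1, b.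
exists (MkZloc y_in); apply: val_inj.
by rewrite rmorphM rmorph_int [RHS]rmorph1 /= mulrCA divff ?mulr1.
Qed.

(** Clearing the denominator of [y], which is prime to [p], brings the divisibility back to the
    integers. *)
Lemma Zloc_dvd_int n (a : int) y :
  a%:~R = p%:R ^+ n * y -> (p%:Z ^+ n %| a)%Z.
Proof.
have [c [b [co_pb yE]]] := Zloc_fracP y.
move/(congr1 ( *%R^~ b%:~R)); rewrite -mulrA yE -[p%:R]/(p%:Z%:~R) -rmorphXn -!rmorphM.
move/Zloc_int_inj => abE.
by rewrite -(@Gauss_dvdzl _ a b) ?coprimezXl // abE dvdz_mulr ?dvdzz.
Qed.

Lemma Zloc_expp_inj n : injective (fun x => p%:R ^+ n * x).
Proof.
move=> x y /(congr1 val); rewrite !rmorphM rmorphXn rmorph_nat /=.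
move/mulfI => xy; apply/val_inj/xy.
by rewrite expf_neq0 // pnatr_eq0 -lt0n prime_gt0.
Qed.

Lemma Zloc_nonunit x : (exists y, x = p%:R * y) \/ exists y, x * y = 1.
Proof.
have [a [b [co_pb xE]]] := Zloc_fracP x.
have [b' bb'] := Zloc_int_unit co_pb.
have {}xE : x = a%:~R * b' by rewrite -xE -mulrA bb' mulr1.
have [/dvdzP[c ac]|ndvd] := boolP (p%:Z %| a)%Z; [left|right].
  by exists (c%:~R * b'); rewrite xE ac rmorphM /= mulrCA mulrA.
have [|a' aa'] := @Zloc_int_unit a; first by rewrite coprimezE prime_coprime.
by exists (a' * b%:~R); rewrite xE -mulrA [b' * _]mulrC -!mulrA bb' mulr1 aa'.
Qed.

Lemma Zloc_residue n x :
  exists i : 'I_(p ^ n), exists y, x = (i : nat)%:R + p%:R ^+ n * y.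
Proof.
have [a [b [co_pb xE]]] := Zloc_fracP x.
have co_pnb : coprimez (p%:Z ^+ n) b by rewrite coprimezXl.
(* For [x = a / b] the residue [i] is the root of [b i = a] modulo [p^n]. *)
have /eqP := card_unit_congruence n (- a) p_pr co_pb.
rewrite -[_ == _]/(_ == 1%N) => /cards1P[i /setP/(_ i)].
rewrite !inE eqxx => /dvdzP[c cE]; exists i.
have [b' bb'] := Zloc_int_unit co_pb; exists (- c%:~R * b').
have -> : x = (x * b%:~R) * b' by rewrite -mulrA bb' mulr1.
have -> : (i : nat)%:R = (i : nat)%:R * b%:~R * b' :> A by rewrite -mulrA bb' mulr1.
rewrite mulrA -mulrDl xE; congr (_ * _).
have -> : a = b * (i : nat)%:Z - c * p%:Z ^+ n by rewrite -cE; ring.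
rewrite rmorphB !rmorphM rmorphXn /=.
by rewrite mulrN [X in _ = X - _]mulrC [X in _ = _ - X]mulrC.
Qed.

Lemma Zloc_residue_uniq n (i j : 'I_(p ^ n)) y :
  (i : nat)%:R = (j : nat)%:R + p%:R ^+ n * y -> i = j.
Proof.
move=> ijE; have /Zloc_dvd_int : ((i : nat)%:Z - (j : nat)%:Z)%:~R = p%:R ^+ n * y.
  by rewrite rmorphB /= -!pmulrn ijE addrC addKr.
rewrite -PoszX -eqz_mod_dvd !modz_nat eqz_nat !modn_small // => /eqP.
exact: val_inj.
Qed.

(** A bounded form of the valuation that also covers [x = 0]: factors [p] are peeled off until a
    unit appears or [n] of them are found. *)
Lemma Zloc_expp_split n x : (exists y, x = p%:R ^+ n * y) \/
  exists2 m, (m < n)%N & exists y, x * y = p%:R ^+ m.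
Proof.
elim: n x => [|n IHn] x; first by left; exists x; rewrite expr0 mul1r.
have [[y ->] | [y xy]] := Zloc_nonunit x; last by right; exists 0%N => //; exists y.
have [[z ->] | [m m_lt [z yz]]] := IHn y; [left | right].
  by exists z; rewrite exprS mulrA.
by exists m.+1 => //; exists z; rewrite -mulrA yz -exprS.
Qed.

Lemma pord_int (a : int) r : (0 < r)%N -> pord (a%:~R : A) = r ->
  exists2 d : int, a = p%:Z ^+ r * d & coprimez p d.
Proof.
(* The default value 0 of [xget] is ruled out by [0 < r], so [r] is a genuine exponent. *)
rewrite /pord; case: xgetP => [s _ /seteqP[sub1 sub2] _ <- {r} | _ /[swap] <- //].
have [|u _ uE] := sub1 (a%:~R); first by exists 1; rewrite ?mulr1.
have /dvdzP[d aE] := Zloc_dvd_int (esym uE); exists d; first by rewrite mulrC.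
rewrite coprimezE prime_coprime //; apply/negP => /dvdzP[e dE].
have [|v _ vE] := sub2 (p%:R ^+ s); first by exists 1; rewrite ?mulr1.
(* If [p] divided [d], then [p^(s+1)] would divide [p^s]. *)
have /Zloc_dvd_int : (p%:Z ^+ s)%:~R = p%:R ^+ s.+1 * (e%:~R * v) :> A.
  rewrite rmorphXn /= -vE aE dE !rmorphM rmorphXn exprS /=.
  by rewrite -[p%:~R]/(p%:R : A); ring.
by rewrite dvdz_Pexp2l ?ltnn // ltz_nat prime_gt1.
Qed.

End Zloc.

(** * Ideals and Hermite normal forms *)

Local Open Scope classical_set_scope.

Lemma card_fset_set_image (T : finType) (U : choiceType) (f : T -> U) (P : {pred T}) :
  {in P &, injective f} ->
  finite_set (f @` [set` P]) /\ #|` fset_set (f @` [set` P])| = #|P|.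
Proof.
move=> f_inj; pose F := [fset u in map f (enum P)]%fset.
have -> : (f @` [set` P]) = [set` F].
  apply/seteqP; split=> [_ [t Pt <-] | u] /=.
    by rewrite in_fsetE map_f ?mem_enum.
  by rewrite in_fsetE => /mapP[t]; rewrite mem_enum => Pt ->; exists t.
split; first exact: finite_fset.
rewrite set_fsetK card_fseq undup_id ?size_map -?cardE //.
by rewrite map_inj_in_uniq ?enum_uniq // => t t'; rewrite !mem_enum; apply: f_inj.
Qed.

(** * Cosets and indices of ideals *)

Section Cosets.

Variables (R : comNzRingType) (I : set R).
Hypothesis ideal_I : is_ideal I.

Lemma idealN u : I u -> I (- u).
Proof. by case: ideal_I => _ _ IM; rewrite -mulN1r; apply: IM. Qed.

Lemma idealB u v : I u -> I v -> I (u - v).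
Proof. by case: ideal_I => _ ID _ Iu /idealN; apply: ID. Qed.

Lemma coset_eq x y :
  ([set z | I (z - x)] = [set z | I (z - y)]) <-> I (x - y).
Proof.
have [I0 ID _] := ideal_I; split=> [/seteqP[sub _] | Ixy].
  by apply: (sub x) => /=; rewrite subrr.
apply/seteqP; split=> z /= Iz.
  by rewrite -[z](subrK x) -addrA; apply: ID.
by rewrite -[z](subrK y) -addrA; apply: ID => //; rewrite -opprB; apply: idealN.
Qed.

Lemma ideal_index_transversal (T : finType) (f : T -> R) :
  (forall x, exists t, I (x - f t)) -> (forall t t', I (f t - f t') -> t = t') ->
  full_ideal I /\ ideal_index I = #|T|.
Proof.
move=> f_ex f_uniq; pose g t : set R := [set z | I (z - f t)].
have cosetsE : cosets I = g @` [set` predT].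
  apply/seteqP; split=> [_ [x _ <-] | _ [t _ <-]]; last by exists (f t).
  by have [t Ixt] := f_ex x; exists t => //; apply/esym/coset_eq.
have [|fin_g card_g] := @card_fset_set_image T (set R) g predT.
  by move=> t t' _ _ /coset_eq /f_uniq.
by split; [split | ]; rewrite ?/ideal_index ?cosetsE.
Qed.

End Cosets.

(* Two of the powers of y are congruent modulo I, and y^i - y^j with i < j is
   the product of y^i and a unit. *)
Lemma full_ideal_expr (R : comNzRingType) (I : set R) (y : R) :
  full_ideal I -> (forall m, exists z, (1 - y ^+ m.+1) * z = 1) ->
  exists n, I (y ^+ n).
Proof.
move=> [ideal_I fin_I] y_unit; apply: contrapT => noI.
pose f n : set R := [set z | I (z - y ^+ n)].
have lt_inj i j : (i < j)%N -> f i <> f j.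
  move=> /subnKC <- /(coset_eq ideal_I) Iij; apply: noI; exists i.
  have [z yz] := y_unit (j - i.+1)%N; have [_ _ IM] := ideal_I.
  rewrite -[y ^+ i]mulr1 -yz.
  have -> : y ^+ i * ((1 - y ^+ (j - i.+1).+1) * z) =
    z * (y ^+ i - y ^+ (i.+1 + (j - i.+1))).
    by rewrite addSnnS exprD; ring.
  exact: IM.
(* Infinitely many distinct cosets of powers would lie among the finitely many cosets of [I]. *)
have : finite_set (f @^-1` cosets I).
  apply: finite_preimage fin_I => i j _ _ fij.
  by case: (ltngtP i j) => // /lt_inj; rewrite fij.
suff -> : f @^-1` cosets I = [set: nat] by exact: infinite_nat.
by apply/seteqP; split=> // i _; exists (y ^+ i).
Qed.

(** * Full ideals as spans of reduced triangular matrices *)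

Section HermiteNormalForm.

Variables (p : nat) (p_pr : prime p) (al be : int).
Local Notation A := (Zloc p_pr).
Variables (R : comNzRingType) (iota : {rmorphism A -> R}) (x : R).

(** Coordinates in a basis that makes multiplication by [x] bidiagonal. The quotient ring enters
    this section only through [x_root] and the existence and uniqueness of these coordinates. *)
Definition comb (z0 z1 z2 : A) : R :=
  iota z0 + iota z1 * x + iota z2 * (x * (x - al%:~R)).

Hypothesis x_root : x * (x - al%:~R) * (x - be%:~R) = 0.
Hypothesis comb_surj : forall r, exists z0 z1 z2, r = comb z0 z1 z2.
Hypothesis comb_eq0 : forall z0 z1 z2,
  comb z0 z1 z2 = 0 -> [/\ z0 = 0, z1 = 0 & z2 = 0].

Lemma combD z0 z1 z2 y0 y1 y2 :
  comb z0 z1 z2 + comb y0 y1 y2 = comb (z0 + y0) (z1 + y1) (z2 + y2).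
Proof. rewrite /comb !rmorphD; ring. Qed.

Lemma combB z0 z1 z2 y0 y1 y2 :
  comb z0 z1 z2 - comb y0 y1 y2 = comb (z0 - y0) (z1 - y1) (z2 - y2).
Proof. rewrite /comb !rmorphB; ring. Qed.

Lemma combZ c z0 z1 z2 :
  iota c * comb z0 z1 z2 = comb (c * z0) (c * z1) (c * z2).
Proof. rewrite /comb !rmorphM; ring. Qed.

Lemma combX z0 z1 z2 :
  x * comb z0 z1 z2 = comb 0 (z0 + al%:~R * z1) (z1 + be%:~R * z2).
Proof.
apply/eqP; rewrite -subr_eq0 /comb !rmorphD !rmorphM !rmorph_int rmorph0.
rewrite (_ : _ - _ = iota z2 * (x * (x - al%:~R) * (x - be%:~R))); last by ring.
by rewrite x_root mulr0.
Qed.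

Lemma comb_inj z0 z1 z2 y0 y1 y2 :
  comb z0 z1 z2 = comb y0 y1 y2 -> [/\ z0 = y0, z1 = y1 & z2 = y2].
Proof.
move/eqP; rewrite -subr_eq0 combB => /eqP/comb_eq0[].
by do 3![move/eqP; rewrite subr_eq0 => /eqP ->].
Qed.

(** The ring is generated by [x] over the scalars. *)
Lemma is_ideal_generators (I : set R) : I 0 ->
  (forall u v, I u -> I v -> I (u + v)) -> (forall c u, I u -> I (iota c * u)) ->
  (forall u, I u -> I (x * u)) -> is_ideal I.
Proof.
move=> I0 ID IZ IX; split=> // r u Iu; have [z0 [z1 [z2 ->]]] := comb_surj r.
have -> : comb z0 z1 z2 * u = iota z0 * u + iota z1 * (x * u)
    + iota z2 * (x * (x * u) + iota (- al%:~R) * (x * u)).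
  by rewrite /comb rmorphN rmorph_int; ring.
apply: (ID); first by apply: (ID); auto.
by apply: (IZ); apply: (ID); auto.
Qed.

(* The span of the rows (p^a, u, v), (0, p^b, w) and (0, 0, p^c). *)
Definition hnf_ideal (a b c : nat) (w u v : int) : set R :=
  [set r | exists s t q : A, r = comb (s * p%:R ^+ a)
     (s * u%:~R + t * p%:R ^+ b) (s * v%:~R + t * w%:~R + q * p%:R ^+ c)].

Lemma hnf_ideal_row1 a b c w u v :
  hnf_ideal a b c w u v (comb (p%:R ^+ a) u%:~R v%:~R).
Proof. by exists 1, 0, 0; congr comb; ring. Qed.

Lemma hnf_ideal_row2 a b c w u v :
  hnf_ideal a b c w u v (comb 0 (p%:R ^+ b) w%:~R).
Proof. by exists 0, 1, 0; congr comb; ring. Qed.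

Lemma hnf_ideal_row3 a b c w u v :
  hnf_ideal a b c w u v (comb 0 0 (p%:R ^+ c)).
Proof. by exists 0, 0, 1; congr comb; ring. Qed.

Let intXE n : p%:R ^+ n = (p%:Z ^+ n)%:~R :> A.
Proof. by rewrite rmorphXn. Qed.

Let mulX_eq0 n (s : A) : 0 = s * p%:R ^+ n -> s = 0.
Proof. by rewrite mulrC -{1}(mulr0 (p%:R ^+ n)) => /Zloc_expp_inj. Qed.

Let mulX_inj n (s t : A) : s * p%:R ^+ n = t * p%:R ^+ n -> s = t.
Proof. by rewrite ![_ * _ ^+ n]mulrC => /Zloc_expp_inj. Qed.

Lemma hnf_ideal_stable a b c w u v :
  is_ideal (hnf_ideal a b c w u v) -> hnf_stable p al be a b c w u v.
Proof.
move=> [_ _ IM]; rewrite /hnf_stable; set X := _ + al * u.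
have [s [t [q]]] := IM x _ (hnf_ideal_row1 a b c w u v).
rewrite combX => /comb_inj[/mulX_eq0 -> + +]; rewrite !mul0r !add0r => tE qE.
have XE : X%:~R = p%:R ^+ b * t :> A.
  by rewrite mulrC -tE /X rmorphD rmorphM /= intXE.
have dvd_X := Zloc_dvd_int XE; rewrite dvd_X /=.
have {tE}tE : t = (X %/ p%:Z ^+ b)%Z%:~R.
  by apply: (@mulX_inj b); rewrite intXE -rmorphM divzK //= XE mulrC intXE.
(* The second coordinate of [x] times row 2 forces [t' = al]; the third then gives the second
   divisibility. *)
have [s' [t' [q']]] := IM x _ (hnf_ideal_row2 a b c w u v).
rewrite combX => /comb_inj[/mulX_eq0 -> + +]; rewrite !mul0r !add0r => /mulX_inj <- q'E.
apply/andP; split.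
  apply: (@Zloc_dvd_int _ p_pr _ _ q'); rewrite [RHS]mulrC.
  apply: (addrI (al%:~R * w%:~R)); rewrite -q'E.
  by rewrite rmorphD rmorphM rmorphB rmorphXn /= -[p%:~R]/(p%:R : A); ring.
apply: (@Zloc_dvd_int _ p_pr _ _ q); rewrite [RHS]mulrC.
apply: (addrI (t * w%:~R)); rewrite -qE tE.
by rewrite rmorphB rmorphD !rmorphM /=; ring.
Qed.

Lemma stable_hnf_ideal a b c w u v :
  hnf_stable p al be a b c w u v -> is_ideal (hnf_ideal a b c w u v).
Proof.
rewrite /hnf_stable; set X := _ + al * u.
case/and3P=> /dvdzP[k kE] /dvdzP[m mE] /dvdzP[l].
rewrite kE mulzK ?expf_neq0 ?eqz_nat -?lt0n ?prime_gt0 // => lE.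
apply: is_ideal_generators.
- by exists 0, 0, 0; rewrite !mul0r !addr0 /comb !rmorph0 !mul0r !addr0.
- move=> _ _ [s [t [q ->]]] [s' [t' [q' ->]]].
  by exists (s + s'), (t + t'), (q + q'); rewrite combD; congr comb; ring.
- move=> d _ [s [t [q ->]]].
  by exists (d * s), (d * t), (d * q); rewrite combZ; congr comb; ring.
move=> _ [s [t [q ->]]].
(* Multiplication by [x] sends row 1 to [k] row 2 + [l] row 3, row 2 to [al] row 2 + [m] row 3, and
   row 3 to [be] row 3. *)
exists 0, (s * k%:~R + al%:~R * t), (s * l%:~R + t * m%:~R + be%:~R * q).
rewrite combX; congr comb; first by rewrite mul0r.
  transitivity (s * (k * p%:Z ^+ b)%:~R + al%:~R * t * p%:R ^+ b); last first.
    by rewrite rmorphM rmorphXn /= -[p%:~R]/(p%:R : A); ring.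
  by rewrite -kE rmorphD rmorphM rmorphXn /= -[p%:~R]/(p%:R : A); ring.
transitivity (s * (l * p%:Z ^+ c)%:~R + t * (m * p%:Z ^+ c)%:~R
  + (s * k%:~R + al%:~R * t) * w%:~R + be%:~R * q * p%:R ^+ c); last first.
  by rewrite !rmorphM !rmorphXn /= -[p%:~R]/(p%:R : A); ring.
rewrite -lE -mE !rmorphB !rmorphD !rmorphM rmorphB rmorphXn /= -[p%:~R]/(p%:R : A).
ring.
Qed.

(** Reducing the coordinates in turn by the three rows leaves unique representatives with entries
    below [p^a], [p^b], [p^c]. *)
Lemma hnf_ideal_index a b c w u v : is_ideal (hnf_ideal a b c w u v) ->
  full_ideal (hnf_ideal a b c w u v) /\
  ideal_index (hnf_ideal a b c w u v) = (p ^ (a + b + c))%N.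
Proof.
move=> ideal_I.
pose f (t : 'I_(p ^ a) * 'I_(p ^ b) * 'I_(p ^ c)) :=
  comb (t.1.1 : nat)%:R (t.1.2 : nat)%:R (t.2 : nat)%:R.
have [||full_I ->] := ideal_index_transversal ideal_I (f := f); last first.
- by rewrite !card_prod !card_ord !expnD.
- move=> [[i j] k] [[i' j'] k'] [s [t [q]]]; rewrite combB => /comb_inj[/= iE].
  have ii : i = i'.
    by apply: (@Zloc_residue_uniq _ p_pr _ _ _ s); rewrite mulrC -iE addrC subrK.
  have s0 : s = 0 by apply: (@mulX_eq0 a); rewrite -iE ii subrr.
  rewrite {}s0 !mul0r !add0r {iE} => jE.
  have jj : j = j'.
    by apply: (@Zloc_residue_uniq _ p_pr _ _ _ t); rewrite mulrC -jE addrC subrK.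
  have t0 : t = 0 by apply: (@mulX_eq0 b); rewrite -jE jj subrr.
  rewrite {}t0 !mul0r !add0r => kE; rewrite ii jj; congr (_, _).
  by apply: (@Zloc_residue_uniq _ p_pr _ _ _ q); rewrite mulrC -kE addrC subrK.
move=> r; have [z0 [z1 [z2 ->]]] := comb_surj r.
have [i [s iE]] := Zloc_residue a z0.
have [j [t jE]] := Zloc_residue b (z1 - s * u%:~R).
have [k [q kE]] := Zloc_residue c (z2 - s * v%:~R - t * w%:~R).
exists (i, j, k), s, t, q; rewrite combB; congr comb => /=.
- by rewrite iE addrC addKr mulrC.
- by rewrite -[z1](subrK (s * u%:~R)) jE; ring.
by rewrite -[z2](subrK (s * v%:~R)) -[z2 - _](subrK (t * w%:~R)) kE; ring.
Qed.

Lemma hnf_ideal_le a b c w u v a' b' c' w' u' v' :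
  (hnf_ideal a b c w u v `<=` hnf_ideal a' b' c' w' u' v') ->
  [/\ (a' <= a)%N, (b' <= b)%N & (c' <= c)%N].
Proof.
have leX m n (s : A) : p%:R ^+ m = s * p%:R ^+ n -> (n <= m)%N.
  rewrite mulrC intXE => /Zloc_dvd_int.
  by rewrite dvdz_Pexp2l // ltz_nat prime_gt1.
move=> sub; split.
- by have [s [t [q /comb_inj[/leX]]]] := sub _ (hnf_ideal_row1 a b c w u v).
- have [s [t [q /comb_inj[/mulX_eq0 -> + _]]]] := sub _ (hnf_ideal_row2 a b c w u v).
  by rewrite mul0r add0r => /leX.
have [s [t [q /comb_inj[/mulX_eq0 -> + +]]]] := sub _ (hnf_ideal_row3 a b c w u v).
by rewrite mul0r add0r => /mulX_eq0 ->; rewrite !mul0r !add0r => /leX.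
Qed.

Lemma hnf_ideal_inj a b c (w : 'I_(p ^ c)) (u : 'I_(p ^ b)) (v : 'I_(p ^ c))
    (w' : 'I_(p ^ c)) (u' : 'I_(p ^ b)) (v' : 'I_(p ^ c)) :
  hnf_ideal a b c (w : nat)%:Z (u : nat)%:Z (v : nat)%:Z =
  hnf_ideal a b c (w' : nat)%:Z (u' : nat)%:Z (v' : nat)%:Z ->
  [/\ w = w', u = u' & v = v'].
Proof.
move=> II.
have : hnf_ideal a b c (w' : nat)%:Z (u' : nat)%:Z (v' : nat)%:Z
    (comb 0 (p%:R ^+ b) (w : nat)%:Z%:~R) by rewrite -II; apply: hnf_ideal_row2.
move=> [s [t [q /comb_inj[/mulX_eq0 -> + +]]]]; rewrite !mul0r !add0r.
rewrite -{1}[_ ^+ b]mul1r => /mulX_inj <-; rewrite mul1r mulrC => wE.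
have ww : w = w' by apply: (Zloc_residue_uniq (y := q)); rewrite pmulrn wE mulrC.
have : hnf_ideal a b c (w' : nat)%:Z (u' : nat)%:Z (v' : nat)%:Z
    (comb (p%:R ^+ a) (u : nat)%:Z%:~R (v : nat)%:Z%:~R).
  by rewrite -II; apply: hnf_ideal_row1.
move=> [s1 [t1 [q1 /comb_inj[]]]]; rewrite -{1}[_ ^+ a]mul1r => /mulX_inj <-.
rewrite !mul1r => uE.
have uu : u = u' by apply: (Zloc_residue_uniq (y := t1)); rewrite pmulrn uE mulrC.
have -> : t1 = 0.
  by apply: (@mulX_eq0 b); apply: (addrI (u : nat)%:Z%:~R); rewrite addr0 {1}uE uu.
rewrite mul0r addr0 => vE; split => //.
by apply: (Zloc_residue_uniq (y := q1)); rewrite pmulrn vE mulrC.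
Qed.

(** With [n] the least exponent such that [J] contains [p^n], an element not divisible by [p^n]
    would put a smaller power into [J]. *)
Lemma ideal_expp_generator (J : set A) N :
  (forall y z, J z -> J (y * z)) -> J (p%:R ^+ N) ->
  exists n, J (p%:R ^+ n) /\ forall z, J z -> exists y, z = y * p%:R ^+ n.
Proof.
move=> JM JN; have exJ : exists n, `[< J (p%:R ^+ n) >] by exists N; apply/asboolP.
case: (ex_minnP exJ) => n /asboolP Jn min_n; exists n; split=> // z Jz.
have [[y ->] | [m m_lt [y zy]]] := Zloc_expp_split n z; first by exists y; rewrite mulrC.
have /asboolP/min_n : J (p%:R ^+ m) by rewrite -zy mulrC; apply: JM.
by rewrite leqNgt m_lt.
Qed.

Lemma full_ideal_expp (I : set R) : full_ideal I -> exists N, I (iota (p%:R ^+ N)).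
Proof.
move=> full_I; have [|N IN] := full_ideal_expr (y := iota p%:R) full_I.
  move=> m; have [|y py] := @Zloc_int_unit _ p_pr (1 - p%:Z ^+ m.+1).
    rewrite coprimezE prime_coprime // -dvdzE dvdzDr; last first.
      by rewrite dvdzN dvdz_exp ?dvdzz.
    by rewrite dvdz1 /= gtn_eqF ?prime_gt1.
  exists (iota y); rewrite -[1](rmorph1 iota) -rmorphXn -rmorphB -rmorphM; congr (iota _).
  by rewrite -[RHS]py rmorphB rmorphXn.
by exists N; rewrite rmorphXn.
Qed.

(** The diagonal generates the ideals of leading coordinates of elements of [I] with zero, one or
    two vanishing initial coordinates; the other entries are then reduced by the lower rows. *)
Lemma full_ideal_hnf (I : set R) : full_ideal I ->
  exists a b c (w : 'I_(p ^ c)) (u : 'I_(p ^ b)) (v : 'I_(p ^ c)),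
    I = hnf_ideal a b c (w : nat)%:Z (u : nat)%:Z (v : nat)%:Z.
Proof.
move=> full_I; have [ideal_I _] := full_I; have [I0 ID IM] := ideal_I.
have IB y z : I y -> I z -> I (y - z) by apply: idealB.
have [N IN] := full_ideal_expp full_I.
have [||a [[u0 [v0 row1]] gen0]] :=
    @ideal_expp_generator [set z | exists u v, I (comb z u v)] N.
- by move=> y z [u [v Iz]]; exists (y * u), (y * v); rewrite -combZ; apply: IM.
- by exists 0, 0; rewrite /comb !rmorph0 !mul0r !addr0.
have [||b [[w0 row2] gen1]] := @ideal_expp_generator [set z | exists w, I (comb 0 z w)] N.
- by move=> y z [w Iz]; exists (y * w); rewrite -[0](mulr0 y) -combZ; apply: IM.
- exists 0; rewrite /comb !rmorph0 !mul0r !addr0 add0r mulrC; exact: IM.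
have [||c [row3 gen2]] := @ideal_expp_generator [set z | I (comb 0 0 z)] N.
- by move=> y z Iz /=; rewrite -[0](mulr0 y) -combZ; apply: IM.
- by rewrite /= /comb !rmorph0 !mul0r !add0r mulrC; apply: IM.
have [w [y wE]] := Zloc_residue c w0.
have {w0 wE} row2 : I (comb 0 (p%:R ^+ b) (w : nat)%:R).
  have := IB _ _ row2 (IM (iota y) _ row3); rewrite combZ combB wE.
  by congr (I (comb _ _ _)); ring.
have [u [y1 uE]] := Zloc_residue b u0.
have {u0 uE} row1 : I (comb (p%:R ^+ a) (u : nat)%:R (v0 - y1 * (w : nat)%:R)).
  have := IB _ _ row1 (IM (iota y1) _ row2); rewrite combZ combB uE.
  by congr (I (comb _ _ _)); ring.
have [v [y2 vE]] := Zloc_residue c (v0 - y1 * (w : nat)%:R).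
have {v0 vE} row1 : I (comb (p%:R ^+ a) (u : nat)%:R (v : nat)%:R).
  have := IB _ _ row1 (IM (iota y2) _ row3); rewrite combZ combB vE.
  by congr (I (comb _ _ _)); ring.
exists a, b, c, w, u, v; apply/seteqP; split=> r; last first.
  move=> [s [t [q ->]]].
  have := ID _ _ (IM (iota s) _ row1) (ID _ _ (IM (iota t) _ row2) (IM (iota q) _ row3)).
  by rewrite !combZ !combD; congr (I (comb _ _ _)); rewrite -?pmulrn; ring.
(* Conversely, the coordinates of an element of [I] are eliminated one at a time. *)
have [z0 [z1 [z2 ->]]] := comb_surj r => Iz.
have [|s sE] := gen0 z0; first by exists z1, z2.
have := IB _ _ Iz (IM (iota s) _ row1); rewrite combZ combB sE subrr => {}Iz.
have [|t tE] := gen1 (z1 - s * (u : nat)%:R); first by exists (z2 - s * (v : nat)%:R).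
have := IB _ _ Iz (IM (iota t) _ row2); rewrite combZ combB tE subrr mulr0 subr0 => {}Iz.
have [|q qE] := gen2 (z2 - s * (v : nat)%:R - t * (w : nat)%:R) => //.
exists s, t, q; rewrite -!pmulrn; congr comb; first by rewrite -tE addrC subrK.
by rewrite -qE; ring.
Qed.

End HermiteNormalForm.

(** * The quotient by the cubic *)

Section CubicQuotient.

Variables (p : nat) (p_pr : prime p) (al be : int).
Local Notation A := (Zloc p_pr).
Local Notation h := (cubic A al be).
Local Notation R := (cubic_quotient p_pr al be).

Definition cubic_iota : {rmorphism A -> R} := (qpolyC h : {rmorphism A -> {poly %/ h}}).
Definition cubic_root : R := in_qpoly h 'X.

Let lift (z0 z1 z2 : A) : {poly A} :=
  z0%:P + z1%:P * 'X + z2%:P * ('X * ('X - (al%:~R)%:P)).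

Let size_h : size (mk_monic h) = 4.
Proof.
have mon c : 'X - c%:P \is @monic A by exact: monicXsubC.
rewrite mk_monic_cubic /cubic size_monicM ?monicMl ?monicX ?monic_neq0 //.
by rewrite size_monicM ?monicX ?monic_neq0 // size_polyX !size_XsubC.
Qed.

Let liftE z0 z1 z2 :
  lift z0 z1 z2 = \poly_(i < 3) [:: z0; z1 - al%:~R * z2; z2]`_i.
Proof.
rewrite poly_def !big_ord_recl big_ord0 /= /bump /= expr0 expr1 /lift.
rewrite -!mul_polyC rmorphB rmorphM /=; ring.
Qed.

Let val_lift z0 z1 z2 :
  in_qpoly h (lift z0 z1 z2) = lift z0 z1 z2 :> {poly A}.
Proof. by apply: in_qpoly_small; rewrite size_h liftE ltnS size_poly. Qed.

Let combE z0 z1 z2 :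
  comb al cubic_iota cubic_root z0 z1 z2 = in_qpoly h (lift z0 z1 z2).
Proof.
have iotaE z : cubic_iota z = in_qpoly h z%:P.
  apply: val_inj; rewrite /= Pdiv.CommonRing.rmodp_small // size_h.
  by rewrite (leq_ltn_trans (size_polyC_leq1 _)).
rewrite /comb !iotaE /lift !rmorphD !rmorphM rmorphB /=.
by congr (_ + _ * (_ * (_ - _))); rewrite !rmorph_int.
Qed.

Lemma cubic_rootE :
  cubic_root * (cubic_root - al%:~R) * (cubic_root - be%:~R) = 0.
Proof.
transitivity (in_qpoly h ('X * ('X - (al%:~R)%:P) * ('X - (be%:~R)%:P)) : R).
  by rewrite !rmorphM !rmorphB /= !rmorph_int.
apply: val_inj; rewrite /= mk_monic_cubic.
exact/Pdiv.RingMonic.rmodpp/cubic_monic.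
Qed.

Lemma cubic_comb_surj r :
  exists z0 z1 z2, r = comb al cubic_iota cubic_root z0 z1 z2.
Proof.
(* Inverse of the change of basis from [1, x, x(x - al)] to monomials. *)
exists (val r)`_0, ((val r)`_1 + al%:~R * (val r)`_2), (val r)`_2.
rewrite combE; apply: val_inj; rewrite [RHS]val_lift liftE addrK.
apply/polyP => i; rewrite coef_poly; case: i => [|[|[|i]]] //=.
apply: nth_default; rewrite -ltnS.
by apply: leq_trans (size_mk_monic r) _; rewrite size_h.
Qed.

Lemma cubic_comb_eq0 z0 z1 z2 :
  comb al cubic_iota cubic_root z0 z1 z2 = 0 -> [/\ z0 = 0, z1 = 0 & z2 = 0].
Proof.
rewrite combE => /(congr1 (@polyn _ _)); rewrite val_lift liftE => /polyP lift0.
have := lift0 2; have := lift0 1%N; have := lift0 0%N.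
rewrite !coef_poly !coef0 /= => z0E z1E z2E; split=> //.
by rewrite z2E mulr0 subr0 in z1E.
Qed.

End CubicQuotient.

(** * Zeta coefficients as counts of normal forms *)

Section ZetaCount.

Variables (p : nat) (p_pr : prime p) (d1 d2 g : int).
Hypotheses (co1 : coprimez p d1) (co2 : coprimez p d2) (cog : coprimez p g).
Hypothesis diffE : p%:Z * d2 - p%:Z * d1 = p%:Z ^+ 2 * g.

Local Notation al := (p%:Z * d1).
Local Notation be := (p%:Z * d2).
Local Notation R := (cubic_quotient p_pr al be).

Let hnf := @hnf_ideal p p_pr al R (cubic_iota p_pr al be) (cubic_root p_pr al be).

Let hnf_of a b c (t : 'I_(p ^ c) * 'I_(p ^ b) * 'I_(p ^ c)) :=
  hnf a b c (t.1.1 : nat)%:Z (t.1.2 : nat)%:Z (t.2 : nat)%:Z.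

Let hnf_index a b c t : t \in hnf_set p al be a b c ->
  full_ideal (hnf_of a t) /\ ideal_index (hnf_of a t) = (p ^ (a + b + c))%N.
Proof.
rewrite inE => stab; apply: hnf_ideal_index; first exact: cubic_comb_surj.
  exact: cubic_comb_eq0.
exact: stable_hnf_ideal (cubic_rootE _ _ _) (@cubic_comb_surj _ _ _ _) _ _ _ _ _ _ stab.
Qed.

Let hnf_ex (I : set R) : full_ideal I -> exists a b c,
  exists2 t, t \in hnf_set p al be a b c & I = hnf_of a t.
Proof.
move=> full_I.
have [a [b [c [w [u [v IE]]]]]] := full_ideal_hnf (@cubic_comb_surj _ _ _ _) full_I.
exists a, b, c, (w, u, v) => //; rewrite inE /=.
apply: (hnf_ideal_stable (cubic_rootE _ _ _) (@cubic_comb_eq0 _ _ _ _)).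
by rewrite -IE; case: full_I.
Qed.

Local Notation index_type n := ('I_n * 'I_n * 'I_n)%type.
Local Notation row_type t :=
  ('I_(p ^ (t.2 : nat)) * 'I_(p ^ (t.1.2 : nat)) * 'I_(p ^ (t.2 : nat)))%type.

(** Normal forms with [a + b + c = k] correspond bijectively to the ideals of index [p^k]:
    inclusions both ways fix the exponents, then reducedness fixes the entries. As [k < n], bounding
    the exponents by [n] loses nothing. *)
Let full_ideals_of_expp n k : (k < n)%N ->
  finite_set (@full_ideals_of_index R (p ^ k)) /\
  #|` fset_set (@full_ideals_of_index R (p ^ k))| =
  (\sum_(t : index_type n | (t.1.1 + t.1.2 + t.2 == k)%N)
     #|hnf_set p al be t.1.1 t.1.2 t.2|)%N.
Proof.
move=> k_lt.
(* A dependent sum, because the ranges of the entries depend on the exponents. *)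
pose T := {t : index_type n & row_type t}.
pose P (y : T) := (((tag y).1.1 + (tag y).1.2 + (tag y).2 == k)%N)
  && (tagged y \in hnf_set p al be (tag y).1.1 (tag y).1.2 (tag y).2).
pose f (y : T) := hnf_of (tag y).1.1 (tagged y).
have f_inj : {in P &, injective f}.
  move=> [[[a b] c] [[w u] v]] [[[a' b'] c'] [[w' u'] v']] _ _ ff.
  have /seteqP[sub sub'] := ff.
  have [/= le_a le_b le_c] := hnf_ideal_le (@cubic_comb_eq0 _ _ _ _) sub.
  have [/= ge_a ge_b ge_c] := hnf_ideal_le (@cubic_comb_eq0 _ _ _ _) sub'.
  have aa : a = a' by apply: val_inj; apply: anti_leq; rewrite ge_a le_a.
  have bb : b = b' by apply: val_inj; apply: anti_leq; rewrite ge_b le_b.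
  have cc : c = c' by apply: val_inj; apply: anti_leq; rewrite ge_c le_c.
  subst a' b' c'.
  by have [/= -> -> ->] := hnf_ideal_inj (@cubic_comb_eq0 _ _ _ _) ff.
have -> : @full_ideals_of_index R (p ^ k) = f @` [set` P].
  apply/seteqP; split=> [I [full_I I_k] | _ [[[[a b] c] t] /andP[/= /eqP abc t_in] <-]].
    have [a [b [c [t t_in IE]]]] := hnf_ex full_I.
    have abc : (a + b + c = k)%N.
      have [_] := hnf_index t_in.
      by rewrite -IE I_k => /(expnI (prime_gt1 p_pr)).
    have lt_a : (a < n)%N by lia.
    have lt_b : (b < n)%N by lia.
    have lt_c : (c < n)%N by lia.
    exists (Tagged (fun t : index_type n => row_type t)
              (i := (Ordinal lt_a, Ordinal lt_b, Ordinal lt_c)) t).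
      by apply/andP; split=> //; apply/eqP.
    by rewrite IE.
  by rewrite -abc; apply: hnf_index.
have [fin ->] := card_fset_set_image f_inj; split=> //.
under eq_bigr do rewrite -sum1_card.
by rewrite -sum1_card sig_big_dep.
Qed.

Lemma cubic_zeta_is_fps : zeta_is_fps p R.
Proof.
split=> [I full_I | k]; last by have [] := full_ideals_of_expp (ltnSn k).
have [a [b [c [t t_in ->]]]] := hnf_ex full_I; exists (a + b + c)%N.
by have [] := hnf_index t_in.
Qed.

Lemma cubic_zetaE n k : (k < n)%N -> zeta p R k = (hnf_gf p%:Z n)`_k.
Proof.
move=> k_lt; have [_ card_k] := full_ideals_of_expp k_lt.
rewrite /zeta card_k coef_hnf_gf pair_big pair_big_dep /= -[LHS]natz natr_sum.
by apply: eq_bigr => t _; rewrite natz (card_hnf_setE p_pr co1 co2 cog diffE).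
Qed.

End ZetaCount.

Theorem proposition4p3 (p : nat) (p_pr : prime p) (alpha beta : int)
    (alpha_neq0 : alpha <> 0) (beta_neq0 : beta <> 0)
    (alpha_neq_beta : alpha <> beta)
    (ord_alpha : pord (alpha%:~R : Zloc p_pr) = 1%N)
    (ord_beta : pord (beta%:~R : Zloc p_pr) = 1%N)
    (ord_diff : pord ((beta - alpha)%:~R : Zloc p_pr) = 2%N) :
  let R := cubic_quotient p_pr alpha beta in
  let q : int := p%:Z in
  zeta_is_fps p R /\
  fps_mul (fps_of_poly ((1 - 'X) ^+ 3)) (zeta p R) =1
  fps_of_poly
    ((q ^+ 4) *: 'X^8 - (2 * q ^+ 3) *: 'X^7 + (q ^+ 3 + q ^+ 2) *: 'X^6
     + (q ^+ 3 - 2 * q ^+ 2) *: 'X^5 + q *: 'X^4 + (q ^+ 2 - 2 * q) *: 'X^3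
     + (q + 1) *: 'X^2 - 2 *: 'X + 1).
Proof.
cbv zeta; clear alpha_neq0 beta_neq0 alpha_neq_beta.
have [d1 alE co1] := pord_int (ltn0Sn 0) ord_alpha.
have [d2 beE co2] := pord_int (ltn0Sn 0) ord_beta.
have [g diffE cog] := pord_int (ltn0Sn 1) ord_diff.
rewrite expr1 in alE beE; clear ord_alpha ord_beta ord_diff; subst alpha beta.
split; first exact: cubic_zeta_is_fps co1 co2 cog diffE.
(* The cut-off [k + 4] exceeds both [k], so that the error term misses degree [k], and 3. *)
move=> k; have [E gfE] := @hnf_gf_numerator p%:Z (k + 4) (leq_addl _ _).
rewrite (@fps_mul_polyE _ (hnf_gf p%:Z (k + 4))) => [|i le_ik].
  by rewrite gfE coefD coefMXn -[X in (X < _)%N]addn0 ltn_add2l addr0.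
by apply: (cubic_zetaE p_pr co1 co2 cog diffE); lia.
Qed.
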